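(* Let $p\ge1$ and $n>p$ be integers, $h=1/n$, $\mathcal{D}\subseteq\{0,1\}$. Let $C_{reg}\in\mathbb{R}^{n_{reg}\times n_{reg}}$ with $(C_{reg})_{ij}=\widehat B_j(y_i)$ for $i,j=1,\dots,n_{reg}$. Then the columns of $U_{reg}=[\sin(y_i\alpha_j+\beta)]_{i,j=1}^{n_{reg}}$ are eigenvectors of $C_{reg}$. Precisely, $$C_{reg}U_{reg}=U_{reg}\Theta,$$ where $\Theta$ is the diagonal matrix with $$(\Theta)_{jj}=\sum_{k=-\lfloor p/2\rfloor}^{\lfloor p/2\rfloor}\widetilde{\mathcal B}_p(k)\cos(kh\alpha_j),\qquad j=1,\dots,n_{reg}.$$
   Context: Symmetric cardinal B-splines: $\widetilde{\mathcal B}_0(x)=1$ if $x\in[-\frac12,\frac12)$ and $0$ otherwise, and for $p\ge1$ $$\widetilde{\mathcal B}_p(x)=\frac{p+1+2x}{2p}\widetilde{\mathcal B}_{p-1}(x+\tfrac12)+\frac{p+1-2x}{2p}\widetilde{\mathcal B}_{p-1}(x-\tfrac12).$$ For integers $i$ let $x_i=ih$ if $p$ is odd and $x_i=(i-\frac12)h$ if $p$ is even; $\delta_p=0$ if $p$ is odd and $\delta_p=1$ if $p$ is even. Let $\widetilde B_i(x)=\widetilde{\mathcal B}_p((x-x_i)/h)$ for $i=-\lfloor\frac{p-1}2\rfloor,\dots,n+\lfloor\frac p2\rfloor$. The special basis is the ordered list $(\widehat B_i)_{i=1}^{n_{reg}}$ obtained by concatenating (in this order) $\mathcal{B}_L$,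 $\mathcal{B}_I$, $\mathcal{B}_R$, where (each listed by increasing $i$; empty index ranges give empty lists): $\mathcal{B}_L$: if $0\in\mathcal{D}$: $\widetilde B_i-\widetilde B_{\delta_p-i}$, $i=1,\dots,\lfloor p/2\rfloor$; if $0\notin\mathcal{D}$ and $p$ even: $\widetilde B_i+\widetilde B_{1-i}$, $i=1,\dots,p/2$; if $0\notin\mathcal{D}$ and $p$ odd: first $\widetilde B_0$, then $\widetilde B_i+\widetilde B_{-i}$, $i=1,\dots,(p-1)/2$. $\mathcal{B}_I$: $\widetilde B_i$, $i=\lfloor p/2\rfloor+1,\dots,n-\lfloor(p+1)/2\rfloor$. $\mathcal{B}_R$: if $1\in\mathcal{D}$: $\widetilde B_i-\widetilde B_{2n+\delta_p-i}$, $i=n-\lfloor(p-1)/2\rfloor,\dots,n-1+\delta_p$; if $1\notin\mathcal{D}$ and $p$ even: $\widetilde B_i+\widetilde B_{2n+1-i}$, $i=n-p/2+1,\dots,n$; if $1\notin\mathcal{D}$ and $p$ odd: $\widetilde B_i+\widetilde B_{2n-i}$, $i=n-(p-1)/2,\dots,n-1$, then $\widetilde B_n$. The number of functions is $n_{reg}=n-1$ if $p$ is odd and $\mathcal{D}=\{0,1\}$; $n_{reg}=n+1$ if $p$ is odd and $\mathcal{D}=\emptyset$; $n_{reg}=n$ otherwise. Evaluation nodes $y_i$, $i=1,\dots,n_{reg}$: if $p$ is even, $y_i=(i-\frac12)h$; if $p$ is odd, $y_i=ih$ when $0\in\mathcal{D}$ and $y_i=(i-1)h$ when $0\notin\mathcal{D}$.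 Frequencies and phase: $\alpha_j=j\pi$ if $\mathcal{D}=\{0,1\}$; $\alpha_j=(j-\frac12)\pi$ if $\mathcal{D}=\{0\}$ or $\mathcal{D}=\{1\}$; $\alpha_j=(j-1)\pi$ if $\mathcal{D}=\emptyset$. $\beta=0$ if $0\in\mathcal{D}$ and $\beta=\pi/2$ if $0\notin\mathcal{D}$. *)

(* Defs.v *)
(* Written over MathComp-Analysis. *)
From HB Require Import structures.
From mathcomp Require Import all_boot all_order all_algebra.
From mathcomp Require Import all_classical all_reals all_analysis.
From mathcomp Require Import zify.

Set Implicit Arguments.
Unset Strict Implicit.
Unset Printing Implicit Defensive.

Import Order.TTheory GRing.Theory Num.Theory.

Local Open Scope ring_scope.

(* Throughout, D : {set 'I_2} is a subset of {0, 1}; its two possible elements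
   are ord0 (= 0) and ord_max (= 1). *)

Fixpoint card_bspline {R : realType} (p : nat) (x : R) {struct p} : R :=
  match p with
  | 0%N => if - 2^-1 <= x < 2^-1 then 1 else 0
  | q.+1 =>
      (p%:R + 1 + 2 * x) / (2 * p%:R) * card_bspline q (x + 2^-1)
      + (p%:R + 1 - 2 * x) / (2 * p%:R) * card_bspline q (x - 2^-1)
  end.

Definition mesh (R : realType) (n : nat) : R := 1 / n%:R.

Definition delta (p : nat) : nat := if odd p then 0%N else 1%N.

Definition center (R : realType) (p n : nat) (i : int) : R :=
  if odd p then i%:~R * mesh R n else (i%:~R - 2^-1) * mesh R n.

Definition Btilde {R : realType} (p n : nat) (i : int) (x : R) : R :=
  card_bspline p ((x - center R p n i) / mesh R n).

(* The index lists below are inclusive, index_iota a b.+1 = [:: a; ...; b], and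
   live in nat: for 0 < p < n none of the subtractions in their bounds is
   truncated.  The reflected indices, which may be negative, live in int. *)

Definition basisL (R : realType) (p n : nat) (D : {set 'I_2}) : seq (R -> R) :=
  if ord0 \in D then
    [seq (fun x => Btilde p n i%:Z x - Btilde p n ((delta p)%:Z - i%:Z) x)
      | i <- index_iota 1 (p./2).+1]
  else if odd p then
    Btilde p n 0 ::
    [seq (fun x => Btilde p n i%:Z x + Btilde p n (- i%:Z) x)
      | i <- index_iota 1 ((p - 1)./2).+1]
  else
    [seq (fun x => Btilde p n i%:Z x + Btilde p n (1 - i%:Z) x)
      | i <- index_iota 1 (p./2).+1].

Definition basisI (R : realType) (p n : nat) : seq (R -> R) :=
  [seq Btilde p n i%:Z | i <- index_iota (p./2).+1 (n - (p.+1)./2).+1].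

Definition basisR (R : realType) (p n : nat) (D : {set 'I_2}) : seq (R -> R) :=
  if ord_max \in D then
    [seq (fun x => Btilde p n i%:Z x
                   - Btilde p n ((2 * n + delta p)%N%:Z - i%:Z) x)
      | i <- index_iota (n - (p - 1)./2) (n - 1 + delta p).+1]
  else if odd p then
    rcons
      [seq (fun x => Btilde p n i%:Z x + Btilde p n ((2 * n)%N%:Z - i%:Z) x)
        | i <- index_iota (n - (p - 1)./2) (n - 1).+1]
      (Btilde p n n%:Z)
  else
    [seq (fun x => Btilde p n i%:Z x + Btilde p n ((2 * n + 1)%N%:Z - i%:Z) x)
      | i <- index_iota (n - p./2 + 1) n.+1].

Definition special_basis (R : realType) (p n : nat) (D : {set 'I_2}) :
    seq (R -> R) :=
  basisL R p n D ++ basisI R p n ++ basisR R p n D.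

Definition nreg (p n : nat) (D : {set 'I_2}) : nat :=
  if odd p && (D == [set: 'I_2]) then (n - 1)%N
  else if odd p && (D == finset.set0) then (n + 1)%N
  else n.

Lemma size_special_basis (R : realType) (p n : nat) (D : {set 'I_2}) :
  (0 < p)%N -> (p < n)%N -> size (special_basis R p n D) = nreg p n D.
Proof.
move=> p0 pn; rewrite !size_cat /basisI size_map size_iota /basisL /basisR.
have DT : (D == [set: 'I_2]) = (ord0 \in D) && (ord_max \in D).
  apply/eqP/andP => [->|[D0 D1]]; first by rewrite !inE.
  apply/setP => i; rewrite inE; have [/eqP i0|/eqP i1] : i = 0%N :> nat \/ i = 1%N :> nat.
  - by case: i => -[|[|//]] ?; [left|right].
  - by rewrite (_ : i = ord0) ?D0//; apply/val_inj/eqP.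
  - by rewrite (_ : i = ord_max) ?D1//; apply/val_inj/eqP.
have D0 : (D == finset.set0) = (ord0 \notin D) && (ord_max \notin D).
  apply/eqP/andP => [->|[D0 D1]]; first by rewrite !inE.
  apply/setP => i; rewrite inE; have [/eqP i0|/eqP i1] : i = 0%N :> nat \/ i = 1%N :> nat.
  - by case: i => -[|[|//]] ?; [left|right].
  - by rewrite (_ : i = ord0) ?(negbTE D0)//; apply/val_inj/eqP.
  - by rewrite (_ : i = ord_max) ?(negbTE D1)//; apply/val_inj/eqP.
rewrite /nreg DT D0 /delta.
case: (ord0 \in D); case: (ord_max \in D); case: ifP => op /=;
  rewrite ?size_rcons ?size_map ?size_iota; lia.
Qed.

(* Indices i, j below are 1-based. *)

Definition Bhat {R : realType} (p n : nat) (D : {set 'I_2}) (j : nat) : R -> R :=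
  nth (fun=> 0) (special_basis R p n D) j.-1.

Definition node (R : realType) (p n : nat) (D : {set 'I_2}) (i : nat) : R :=
  if odd p then
    if ord0 \in D then i%:R * mesh R n else (i%:R - 1) * mesh R n
  else (i%:R - 2^-1) * mesh R n.

Definition freq (R : realType) (D : {set 'I_2}) (j : nat) : R :=
  if D == [set: 'I_2] then j%:R * pi
  else if D == finset.set0 then (j%:R - 1) * pi
  else (j%:R - 2^-1) * pi.

Definition phase (R : realType) (D : {set 'I_2}) : R :=
  if ord0 \in D then 0 else pi / 2.

Definition Creg (R : realType) (p n : nat) (D : {set 'I_2}) :
    'M[R]_(nreg p n D) :=
  \matrix_(i, j) Bhat p n D j.+1 (node R p n D i.+1).

Definition Ureg (R : realType) (p n : nat) (D : {set 'I_2}) :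
    'M[R]_(nreg p n D) :=
  \matrix_(i, j) sin (node R p n D i.+1 * freq R D j.+1 + phase R D).

(* The sum over k = - p./2, ..., p./2, reindexed by m = k + p./2. *)
Definition symbol (R : realType) (p n : nat) (D : {set 'I_2}) (j : nat) : R :=
  \sum_(0 <= m < (2 * p./2).+1)
    let k : R := m%:R - (p./2)%:R in
    card_bspline p k * cos (k * mesh R n * freq R D j).

Definition Theta (R : realType) (p n : nat) (D : {set 'I_2}) :
    'M[R]_(nreg p n D) :=
  diag_mx (\row_j symbol R p n D j.+1).

(* The library's eigenspace is about row vectors; this one is for columns. *)
Definition col_eigenvector (F : fieldType) (N : nat) (A : 'M[F]_N)
    (v : 'cV[F]_N) : Prop :=
  v != 0 /\ exists a : F, A *m v = a *: v.

(* Main.v *)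
Require Import Defs.
From mathcomp Require Import all_boot all_order all_algebra.
From mathcomp Require Import all_classical all_reals all_analysis.
From mathcomp Require Import zify ring lra.
Import Order.TTheory GRing.Theory Num.Theory.
Local Open Scope ring_scope.

(* At the nodes only the values b(k) of the B-spline at integers occur, and b is
   even with b(k) = 0 for |k| > p/2.  Put s(k) = sin(x_k alpha_j + beta) for all
   integers k.  By the addition theorem, the full-lattice convolution of b with
   s is symbol * s.  Moreover s is odd or even, according to the boundary
   condition, about each of the points 0 and 1, and the basis functions at the
   boundary are those obtained by folding the lattice at these two points.  So
   row i of C_reg U_reg is this convolution, its terms grouped into the three
   copies of the index range. *)

(** * Values of the B-spline at the integers *)

Lemma card_bspline_right0 (R : realType) (p : nat) (x : R) :
  p.+1%:R / 2 <= x -> card_bspline p x = 0.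
Proof.
elim: p x => [|p IH] x /=; first by move=> hx; case: ifP => // /andP[]; lra.
by rewrite -natr1 => hx; rewrite !IH ?mulr0 ?addr0//; lra.
Qed.

(** Reflection swaps the two terms of the recursion. The induction starts at degree 1, because
    degree 0, supported on a half-open interval, is not even at the points 1/2 and -1/2. *)
Lemma card_bsplineN (R : realType) (p : nat) (x : R) :
  (0 < p)%N -> card_bspline p (- x) = card_bspline p x.
Proof.
case: p => // p _; elim: p x => [|p IH] x.
  rewrite /=; do 4 case: ifP; move=> h1 h2 h3 h4; lra.
rewrite [LHS]/= [RHS]/= -/(card_bspline p.+1 _).
have -> : - x + 2^-1 = - (x - 2^-1) by ring.
have -> : - x - 2^-1 = - (x + 2^-1) by ring.
rewrite -![_ * card_bspline p _ + _ * card_bspline p _]/(card_bspline p.+1 _).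
by rewrite !IH addrC mulrN opprK.
Qed.

Lemma card_bspline_int0 (R : realType) (p : nat) (k : int) :
  (0 < p)%N -> (p./2 < `|k|)%N -> card_bspline p (k%:~R : R) = 0.
Proof.
move=> p0; wlog k0 : k / 0 <= k => [wl|hk].
  have [k0|k0] := leP 0 k; first exact: wl.
  by move=> hk; rewrite -[k]opprK rmorphN /= card_bsplineN// wl//; lia.
apply: card_bspline_right0.
(* For odd p equality can occur: k is then the right end of the support, which [card_bspline_right0]
   includes. *)
have : (p.+1%:Z <= k * 2) by lia.
rewrite -(ler_int R) rmorphM /= -pmulrn => ?; lra.
Qed.

(** * Lattice positions and the reflections about 0 and 1 *)

(* Row (or column) number i, counted from 0, sits at lattice position
   i + offset, that is y_(i+1) = x_(i + offset). *)
Definition offset (p : nat) (D : {set 'I_2}) : nat := ~~ odd p || (ord0 \in D).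

Lemma node_center (R : realType) (p n : nat) (D : {set 'I_2}) (i : nat) :
  node R p n D i.+1 = Defs.center R p n (i + offset p D)%:Z.
Proof.
rewrite /node /Defs.center /offset -pmulrn.
by case: (odd p); case: (ord0 \in D); rewrite /= ?addn0 ?addn1 -?natr1 ?addrK.
Qed.

Lemma Btilde_center (R : realType) (p n : nat) (k l : int) :
  (0 < n)%N ->
  Btilde p n k (Defs.center R p n l) = card_bspline p ((l - k)%:~R : R).
Proof.
move=> n0; have n0R : n%:R != 0 :> R by rewrite pnatr_eq0 -lt0n.
by rewrite /Btilde /Defs.center /mesh rmorphB /=; case: odd; congr card_bspline; field.
Qed.

Lemma centerD (R : realType) (p n : nat) (k l : int) :
  Defs.center R p n (k + l) = Defs.center R p n k + l%:~R * mesh R n.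
Proof. by rewrite /Defs.center rmorphD /=; case: odd; ring. Qed.

Lemma center_reflL (R : realType) (p n : nat) (k : int) :
  Defs.center R p n ((delta p)%:Z - k) = - Defs.center R p n k.
Proof.
by rewrite /Defs.center /delta rmorphB /= -pmulrn; case: odd => /=; field.
Qed.

Lemma center_reflR (R : realType) (p n : nat) (k : int) :
  (0 < n)%N ->
  Defs.center R p n ((2 * n + delta p)%N%:Z - k) = 2 - Defs.center R p n k.
Proof.
move=> n0; have n0R : n%:R != 0 :> R by rewrite pnatr_eq0 -lt0n.
by rewrite /Defs.center /delta /mesh rmorphB /= -pmulrn natrD natrM; case: odd => /=; field.
Qed.

Lemma eq_setT_I2 (D : {set 'I_2}) :
  (D == [set: 'I_2]) = (ord0 \in D) && (ord_max \in D).
Proof.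
apply/eqP/andP => [->|[D0 D1]]; first by rewrite !inE.
apply/setP => i; rewrite inE.
by have [->|->] : i = ord0 \/ i = ord_max
  by case: i => -[|[|//]] ?; [left|right]; apply/val_inj.
Qed.

Lemma eq_set0_I2 (D : {set 'I_2}) :
  (D == finset.set0) = (ord0 \notin D) && (ord_max \notin D).
Proof.
apply/eqP/andP => [->|[D0 D1]]; first by rewrite !inE.
apply/setP => i; rewrite inE; apply/negbTE.
by have [->|->] : i = ord0 \/ i = ord_max
  by case: i => -[|[|//]] ?; [left|right]; apply/val_inj.
Qed.

(** * The sampled sine wave s, with j counted from 1, and its symmetries *)

Definition wave (R : realType) (p n : nat) (D : {set 'I_2}) (j : nat) (k : int)
    : R :=
  sin (Defs.center R p n k * freq R D j + phase R D).

(** The cosine parts of the addition theorem cancel between the shifts by l and -l. *)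
Lemma waveDB (R : realType) (p n : nat) (D : {set 'I_2}) (j : nat) (k l : int) :
  wave R p n D j (k + l) + wave R p n D j (k - l)
  = 2 * (cos (l%:~R * mesh R n * freq R D j) * wave R p n D j k).
Proof.
rewrite /wave !centerD rmorphN /=.
set x := Defs.center R p n k; set a := freq R D j; set b := phase R D.
set y := l%:~R * mesh R n.
have -> : (x + y) * a + b = (x * a + b) + y * a by ring.
have -> : (x + - l%:~R * mesh R n) * a + b = (x * a + b) - y * a.
  by rewrite /y; ring.
by rewrite sinD sinB; ring.
Qed.

Lemma wave_reflL (R : realType) (p n : nat) (D : {set 'I_2}) (j : nat) (k : int) :
  wave R p n D j ((delta p)%:Z - k) = (-1) ^+ (ord0 \in D) * wave R p n D j k.
Proof.
rewrite /wave center_reflL mulNr /phase; case: (ord0 \in D) => /=.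
  by rewrite !addr0 sinN mulN1r.
by rewrite !sinDpihalf cosN expr0 mul1r.
Qed.

(** Reflection about 1 negates the x-part of the angle and adds twice the frequency. The latter is a
    multiple of 2 pi if both ends carry the same condition and an odd multiple of pi otherwise,
    which flips the parity inherited from 0. *)
Lemma wave_reflR (R : realType) (p n : nat) (D : {set 'I_2}) (j : nat) (k : int) :
  (0 < n)%N ->
  wave R p n D j.+1 ((2 * n + delta p)%N%:Z - k)
  = (-1) ^+ (ord_max \in D) * wave R p n D j.+1 k.
Proof.
move=> n0; rewrite /wave center_reflR// /freq /phase eq_setT_I2 eq_set0_I2 -[j.+1%:R]natr1.
set x := Defs.center R p n k.
have pi2n m : pi *+ 2 *+ m = 2 * m%:R * pi :> R.
  by rewrite -mulrnA -[pi *+ _]mulr_natr natrM; ring.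
have pD m := periodicn (@sinD2pi R) m.
have pC m := periodicn (@cosD2pi R) m.
case: (ord0 \in D); case: (ord_max \in D) => /=; rewrite ?addr0 ?mulN1r ?mul1r ?sinDpihalf.
- rewrite (_ : (2 - x) * _ = - (x * ((j%:R + 1) * pi)) + (pi *+ 2) *+ j.+1) ?pD ?sinN//.
  by rewrite pi2n -[j.+1%:R]natr1; ring.
- rewrite (_ : (2 - x) * _ = (- (x * ((j%:R + 1 - 2^-1) * pi)) + pi) + (pi *+ 2) *+ j).
    by rewrite pD sinDpi sinN opprK.
  by rewrite pi2n; field.
- rewrite (_ : (2 - x) * _ = (- (x * ((j%:R + 1 - 2^-1) * pi)) + pi) + (pi *+ 2) *+ j).
    by rewrite pC cosDpi cosN.
  by rewrite pi2n; field.
- rewrite (_ : (2 - x) * _ = - (x * ((j%:R + 1 - 1) * pi)) + (pi *+ 2) *+ j) ?pC ?cosN//.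
  by rewrite pi2n; ring.
Qed.

(** Serves to show that no column of [Ureg] vanishes: the bound on [j] keeps the angle at the first
    node strictly between 0 and pi. *)
Lemma wave_first_gt0 (R : realType) (p n : nat) (D : {set 'I_2}) (j : nat) :
  (1 < n)%N -> (j < nreg p n D)%N ->
  0 < wave R p n D j.+1 (offset p D)%:Z.
Proof.
move=> n1; rewrite /nreg eq_setT_I2 eq_set0_I2 => jN; apply: sin_gt0_pi.
suff [a -> /andP[a0 a1]] : exists2 a : R,
    Defs.center R p n (offset p D)%:Z * freq R D j.+1 + phase R D = a * pi
    & 0 < a < 1.
  by rewrite mulr_gt0 ?pi_gt0// gtr_pMl ?pi_gt0.
have n0R : n%:R != 0 :> R by rewrite pnatr_eq0; lia.
have h0 : 0 < mesh R n by rewrite /mesh divr_gt0// ltr0n; lia.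
have h2 : 2 * mesh R n <= 1.
  by rewrite /mesh mulrA mulr1 ler_pdivrMr ?mul1r ?ler_nat// ltr0n; lia.
have jh0 : 0 <= j%:R * mesh R n by rewrite mulr_ge0// ltW.
have jh (m : nat) : (j + m <= n)%N -> j%:R * mesh R n + m%:R * mesh R n <= 1.
  move=> jmn; rewrite -mulrDl -natrD /mesh mulrA mulr1.
  by rewrite ler_pdivrMr ?mul1r ?ler_nat// ltr0n; lia.
rewrite /Defs.center /offset /freq /phase eq_setT_I2 eq_set0_I2.
rewrite -[j.+1%:R]natr1; move: jN.
set h := mesh R n in h0 h2 jh0 jh *.
case: odd; case: (ord0 \in D); case: (ord_max \in D) => /= jN.
- have  := jh 2%N ltac:(lia) => {}jh; exists ((j%:R + 1) * h); [by ring|lra].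
- have := jh 1%N ltac:(lia) => {}jh; exists ((j%:R + 2^-1) * h); [by field|lra].
(* For p odd and 0 not in D the first node is 0, so the angle is the phase pi / 2. *)
- by exists 2^-1; [field|lra].
- by exists 2^-1; [field|lra].
- have := jh 1%N ltac:(lia) => {}jh; exists ((j%:R + 1) * h / 2); [by field|lra].
- have := jh 1%N ltac:(lia) => {}jh; exists ((j%:R + 2^-1) * h / 2); [by field|lra].
- have := jh 1%N ltac:(lia) => {}jh; exists ((j%:R + 2^-1) * h / 2 + 2^-1); [by field|lra].
- have := jh 1%N ltac:(lia) => {}jh; exists (j%:R * h / 2 + 2^-1); [by field|lra].
Qed.

(** * The special basis as a folding of the B-splines *)

Lemma nth_map_index_iota (T : Type) (x0 : T) (f : nat -> T) (a b i : nat) :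
  (i < b - a)%N -> nth x0 [seq f k | k <- index_iota a b] i = f (a + i)%N.
Proof. by move=> h; rewrite (nth_map 0%N) ?size_iota// nth_iota. Qed.

Lemma size_basisL (R : realType) (p n : nat) (D : {set 'I_2}) :
  (size (basisL R p n D) = (p./2).+1 - offset p D)%N.
Proof.
rewrite /basisL /offset.
by case: (ord0 \in D); case op: (odd p); rewrite /= ?size_map ?size_iota; lia.
Qed.

(** The guard fails only at k = 0, for p odd and 0 not in D: this spline is its own mirror image and
    is not doubled. *)
Lemma nth_basisL (R : realType) (p n : nat) (D : {set 'I_2}) (i : nat) (x : R) :
  let k := (i + offset p D)%N in
  (k <= p./2)%N ->
  nth (fun=> 0) (basisL R p n D) i x =
    Btilde p n k%:Z x
    + (if (0 < k)%N
       then (-1) ^+ (ord0 \in D) * Btilde p n ((delta p)%:Z - k%:Z) x else 0).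
Proof.
rewrite /basisL /offset /delta; case: (ord0 \in D); case op: (odd p) => /=;
  rewrite ?orbT ?addn0 ?addn1 /= ?expr0 ?mulN1r ?mul1r => ki.
- by rewrite nth_map_index_iota ?add1n//; lia.
- by rewrite nth_map_index_iota ?add1n//; lia.
- case: i ki => [|i] ki /=; first by rewrite addr0.
  by rewrite nth_map_index_iota ?add1n ?sub0r//; lia.
- by rewrite nth_map_index_iota ?add1n//; lia.
Qed.

(** All variants of the list start at the same position. The guard fails only at k = n, for p odd
    and 1 not in D, where the spline is its own mirror image. *)
Lemma nth_basisR (R : realType) (p n : nat) (D : {set 'I_2}) (i : nat) (x : R) :
  (0 < p)%N -> (p < n)%N ->
  let k := ((n - uphalf p).+1 + i)%N in
  (k < n + delta p + (odd p && (ord_max \notin D)))%N ->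
  nth (fun=> 0) (basisR R p n D) i x =
    Btilde p n k%:Z x
    + (if (k < n + delta p)%N
       then (-1) ^+ (ord_max \in D)
            * Btilde p n ((2 * n + delta p)%N%:Z - k%:Z) x else 0).
Proof.
move=> p0 pn; rewrite /basisR /delta.
case: (ord_max \in D); case op: (odd p) => /=; rewrite ?addn0 ?addn1 => ki.
- rewrite nth_map_index_iota; last by lia.
  have <- : (n - (p - 1)./2 + i = (n - uphalf p).+1 + i)%N by lia.
  by rewrite ifT ?mulN1r//; lia.
- rewrite nth_map_index_iota; last by lia.
  have <- : (n - (p - 1)./2 + i = (n - uphalf p).+1 + i)%N by lia.
  by rewrite ifT ?mulN1r//; lia.
- rewrite nth_rcons size_map size_iota; case: ltnP => hi.
    rewrite nth_map_index_iota //.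
    have <- : (n - (p - 1)./2 + i = (n - uphalf p).+1 + i)%N by lia.
    by rewrite ifT ?mul1r//; lia.
  have -> : ((n - uphalf p).+1 + i = n)%N by lia.
  by rewrite ifT ?ltnn ?addr0//; lia.
- rewrite nth_map_index_iota; last by lia.
  have <- : (n - p./2 + 1 + i = (n - uphalf p).+1 + i)%N by lia.
  by rewrite ifT ?mul1r ?addn1//; lia.
Qed.

(** Since p < n, the two folded ranges are disjoint, so at most one reflected term is present. *)
Lemma Bhat_fold (R : realType) (p n : nat) (D : {set 'I_2}) (j : nat) (x : R) :
  (0 < p)%N -> (p < n)%N -> (j < nreg p n D)%N ->
  let k := (j + offset p D)%N in
  Bhat p n D j.+1 x =
    Btilde p n k%:Z x
    + (if (0 < k <= p./2)%N
       then (-1) ^+ (ord0 \in D) * Btilde p n ((delta p)%:Z - k%:Z) x else 0)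
    + (if (n - uphalf p < k < n + delta p)%N
       then (-1) ^+ (ord_max \in D)
            * Btilde p n ((2 * n + delta p)%N%:Z - k%:Z) x else 0).
Proof.
move=> p0 pn jN k.
have kN : (k < n + delta p + (odd p && (ord_max \notin D)))%N.
  move: jN; rewrite /k /nreg /offset /delta eq_setT_I2 eq_set0_I2.
  by case: (ord0 \in D); case: (ord_max \in D); case: (odd p) => /=; lia.
have o1 : (offset p D <= 1)%N by rewrite /offset; case: (_ || _).
rewrite /Bhat /special_basis !nth_cat /basisI size_basisL size_map size_iota /=.
case: ltnP => [jL|jL].
  rewrite nth_basisL -/k; last by lia.
  have -> : (k <= p./2)%N by lia.
  by rewrite andbT [X in _ = _ + X]ifF ?addr0//; lia.
rewrite [X in _ = _ + X + _]ifF ?addr0; last by lia.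
case: ltnP => [jI|jI].
  rewrite nth_map_index_iota// ifF ?addr0; last by lia.
  by congr (Btilde _ _ (Posz _) _); lia.
rewrite (_ : j - _ - _ = k - (n - uphalf p).+1)%N; last by lia.
have k_ge : ((n - uphalf p).+1 <= k)%N by lia.
by rewrite nth_basisR ?subnKC ?k_ge.
Qed.

Lemma position_bounds (p n : nat) (D : {set 'I_2}) (i : nat) :
  (i < nreg p n D)%N -> (delta p <= i + offset p D <= n)%N.
Proof.
rewrite /nreg /offset /delta eq_setT_I2 eq_set0_I2.
by case: (ord0 \in D); case: (ord_max \in D); case: (odd p) => /=; lia.
Qed.

(* The ranges 0 < k and k < n + delta p replace those of Bhat_fold because, at the
   nodes, the reflected splines of the further indices vanish. *)
Lemma Bhat_node (R : realType) (p n : nat) (D : {set 'I_2}) (i j : nat) :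
  (0 < p)%N -> (p < n)%N -> (i < nreg p n D)%N -> (j < nreg p n D)%N ->
  let l := (i + offset p D)%N in
  let k := (j + offset p D)%N in
  Bhat p n D j.+1 (node R p n D i.+1) =
    card_bspline p (l%:Z - k%:Z)%:~R
    + (if (0 < k)%N
       then (-1) ^+ (ord0 \in D)
            * card_bspline p (l%:Z - ((delta p)%:Z - k%:Z))%:~R else 0)
    + (if (k < n + delta p)%N
       then (-1) ^+ (ord_max \in D)
            * card_bspline p (l%:Z - ((2 * n + delta p)%N%:Z - k%:Z))%:~R
       else 0).
Proof.
move=> p0 pn iN jN l k.
have /andP[l0 ln] := position_bounds _ _ _ _ iN.
rewrite Bhat_fold// node_center -/l -/k !Btilde_center; try by lia.
congr (_ + _ + _).
  case: (ltnP 0 k) => //= k0; case: leqP => // kq.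
  by rewrite card_bspline_int0 ?mulr0//; lia.
case: (ltnP k) => [kn|]; last by rewrite andbF.
rewrite andbT; case: ltnP => // kq.
(* The mirror position is at least n + delta + uphalf p, while l <= n; the distance exceeds p/2, for
   even p because delta = 1. *)
rewrite card_bspline_int0 ?mulr0//.
move: l0; rewrite -/l /delta in ln *; case op: (odd p) => /= l0; lia.
Qed.

(** * The convolution on the lattice and its folding *)

Lemma symbol_mul_wave (R : realType) (p n : nat) (D : {set 'I_2}) (j : nat)
    (l : int) :
  (0 < p)%N ->
  symbol R p n D j * wave R p n D j l =
  \sum_(0 <= m < (2 * p./2).+1)
    card_bspline p (m%:Z - (p./2)%:Z)%:~R
    * wave R p n D j (l + (m%:Z - (p./2)%:Z)).
Proof.
move=> p0; set w := RHS.
have w_rev : w = \sum_(0 <= m < (2 * p./2).+1)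
    card_bspline p (m%:Z - (p./2)%:Z)%:~R
    * wave R p n D j (l - (m%:Z - (p./2)%:Z)).
  rewrite /w big_nat_rev /=; apply: eq_big_nat => m /andP[_ hm].
  have -> : (0 + (2 * p./2).+1 - m.+1)%N%:Z - (p./2)%:Z = - (m%:Z - (p./2)%:Z).
    by lia.
  by rewrite rmorphN /= card_bsplineN.
(* Adding the sum to its reversal pairs s(l + k) with s(l - k), so that [waveDB] applies. *)
apply: (@mulfI _ 2); first by rewrite pnatr_eq0.
rewrite [RHS]mulr_natl [RHS]mulr2n {2}w_rev /w -big_split /= /symbol.
rewrite mulr_suml mulr_sumr; apply: eq_big_nat => m _.
by rewrite -mulrDr waveDB rmorphB /= -!pmulrn; ring.
Qed.

(** The window runs from delta - n to 2n, the union of the positions delta, ..., n and their mirror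
    images. It contains the support of b around l because p < n. *)
Lemma symbol_mul_wave_window (R : realType) (p n : nat) (D : {set 'I_2})
    (j l : nat) :
  (0 < p)%N -> (p < n)%N -> (delta p <= l <= n)%N ->
  symbol R p n D j * wave R p n D j l%:Z =
  \sum_(0 <= t < (3 * n).+1 - delta p)
    (let k := t%:Z - n%:Z + (delta p)%:Z in
     card_bspline p (l%:Z - k)%:~R * wave R p n D j k).
Proof.
move=> p0 pn /andP[l0 ln]; set G : nat -> R := BIG_F; rewrite symbol_mul_wave//.
have d1 : (delta p <= 1)%N by rewrite /delta; case: odd.
(* The value of t at which k = l - p./2, where the support begins. *)
pose a := (l + n - delta p - p./2)%N.
rewrite [RHS](@big_cat_nat _ _ _ a) /=; [|by rewrite /a; lia..].
rewrite [X in _ = _ + X](@big_cat_nat _ _ _ (a + (2 * p./2).+1) a) /=; [|by rewrite /a; lia..].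
rewrite [X in _ = X + _]big_nat [X in _ = X + _]big1 ?add0r; last first.
  move=> t /andP[_ ta]; rewrite /G card_bspline_int0 ?mul0r//.
  by rewrite /a in ta; lia.
rewrite [X in _ = _ + X]big_nat [X in _ = _ + X]big1 ?addr0; last first.
  move=> t /andP[ta _]; rewrite /G card_bspline_int0 ?mul0r//.
  by rewrite /a in ta; lia.
rewrite -{1}[a]add0n big_addn addKn; apply: eq_big_nat => m _; rewrite /G.
have -> : (m + a)%N%:Z - n%:Z + (delta p)%:Z = l%:Z + (m%:Z - (p./2)%:Z).
  by rewrite /a; lia.
rewrite (_ : l%:Z - _ = - (m%:Z - (p./2)%:Z)); last by lia.
by rewrite rmorphN /= card_bsplineN.
Qed.

(* With a Dirichlet condition and p odd, the end point of the lattice carries no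
   basis function; it may be added to the sum since the wave vanishes there. *)
Lemma sum_positions (V : nmodType) (p n : nat) (D : {set 'I_2}) (F : nat -> V) :
  (1 < n)%N ->
  (odd p -> ord0 \in D -> F 0%N = 0) ->
  (odd p -> ord_max \in D -> F n = 0) ->
  \sum_(0 <= m < nreg p n D) F (m + offset p D)%N =
  \sum_(delta p <= k < n.+1) F k.
Proof.
move=> n1 F0 Fn.
have -> : \sum_(0 <= m < nreg p n D) F (m + offset p D)%N
    = \sum_(0 + offset p D <= k < offset p D + nreg p n D) F k.
  by rewrite big_addn addKn.
rewrite add0n /offset /nreg /delta eq_setT_I2 eq_set0_I2.
case: (odd p) F0 Fn; case: (ord0 \in D); case: (ord_max \in D) => /= F0 Fn;
  rewrite ?add0n ?add1n ?addn1 //.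
- rewrite subn1 prednK 1?ltnW// [RHS]big_ltn// F0// add0r.
  by rewrite [RHS]big_nat_recr 1?ltnW //= Fn ?addr0.
- by rewrite [RHS]big_ltn ?F0 ?add0r.
- by rewrite [RHS]big_nat_recr //= Fn ?addr0.
Qed.

Lemma Bhat_row_sum (R : realType) (p n : nat) (D : {set 'I_2}) (i j : nat) :
  (0 < p)%N -> (p < n)%N -> (i < nreg p n D)%N ->
  \sum_(0 <= m < nreg p n D) Bhat p n D m.+1 (node R p n D i.+1)
    * wave R p n D j.+1 (m + offset p D)%:Z =
  symbol R p n D j.+1 * wave R p n D j.+1 (i + offset p D)%:Z.
Proof.
move=> p0 pn iN; have /position_bounds lb := iN.
rewrite symbol_mul_wave_window//; set G : nat -> R := (X in _ = \sum_(0 <= t < _) X t).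
set s := wave R p n D j.+1; set l := (i + offset p D)%N in lb *.
have d1 : (delta p <= 1)%N by rewrite /delta; case: odd.
pose b (k : int) : R := card_bspline p (l%:Z - k)%:~R.
(* The convolution terms at k and at its two mirror images; the signs in [Bhat_node] are absorbed by
   the parity of s. *)
pose F (k : nat) : R := b k * s k
  + (if (0 < k)%N then b ((delta p)%:Z - k%:Z) * s ((delta p)%:Z - k%:Z) else 0)
  + (if (k < n + delta p)%N then b ((2 * n + delta p)%N%:Z - k%:Z)
       * s ((2 * n + delta p)%N%:Z - k%:Z) else 0).
have FE m : (m < nreg p n D)%N ->
    Bhat p n D m.+1 (node R p n D i.+1) * s (m + offset p D)%N%:Z
    = F (m + offset p D)%N.
  move=> mN; rewrite Bhat_node// -/l /F /s wave_reflL wave_reflR; last by lia.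
  by rewrite /b; case: ifP => _; case: ifP => _; ring.
(* An end point of the lattice is its own mirror image, so an odd s vanishes there. *)
have s0 : odd p -> ord0 \in D -> s 0 = 0.
  move=> op D0; have := wave_reflL R p n D j.+1 0.
  by rewrite /delta op D0 subr0 -/s mulN1r => h; lra.
have sn : odd p -> ord_max \in D -> s n%:Z = 0.
  move=> op D1; have := wave_reflR R p n D j n%:Z ltac:(lia).
  rewrite /delta op D1 addn0 (_ : (2 * n)%N%:Z - n%:Z = n%:Z); last by lia.
  by rewrite -/s mulN1r => h; lra.
have -> : \sum_(0 <= m < nreg p n D) Bhat p n D m.+1 (node R p n D i.+1)
    * s (m + offset p D)%N%:Z = \sum_(delta p <= k < n.+1) F k.
  rewrite (eq_big_nat _ _ (fun m hm => FE m (andP hm).2)).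
  have F0 k : s k%:Z = 0 -> F k = 0.
    move=> sk; rewrite /F /s wave_reflL wave_reflR -/s; last by lia.
    by rewrite sk !mulr0 !if_same !addr0.
  by apply: sum_positions => [|op D0|op D1]; [lia|apply/F0/s0|apply/F0/sn].
have shift m N (H : nat -> R) :
    \sum_(m <= k < N) H k = \sum_(0 <= i < N - m) H (i + m)%N.
  by rewrite -{1}[m]add0n big_addn.
rewrite !big_split /= -addrA addrCA.
(* The cuts are at k = delta and k = n + 1; the pieces are the left mirror image, the positions
   themselves and the right mirror image. *)
rewrite [RHS](@big_cat_nat _ _ _ n) /=; [|lia..].
rewrite [X in _ = _ + X](@big_cat_nat _ _ _ ((2 * n).+1 - delta p) n) /=; [|lia..].
congr (_ + (_ + _)).
(* For p odd the self-mirrored position 0 drops out, as n does in the right piece; otherwise it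
   would be counted twice. *)
- have -> : \sum_(delta p <= k < n.+1)
      (if (0 < k)%N then b ((delta p)%:Z - k%:Z) * s ((delta p)%:Z - k%:Z) else 0)
    = \sum_(1 <= k < n.+1) b ((delta p)%:Z - k%:Z) * s ((delta p)%:Z - k%:Z).
    rewrite /delta; case: odd; first rewrite big_ltn//= add0r.
      by apply: eq_big_nat => k /andP[k0 _]; rewrite k0.
    by apply: eq_big_nat => k /andP[k0 _]; rewrite k0.
  rewrite shift subn1 big_nat_rev; apply: eq_big_nat => t /andP[_ tn].
  by rewrite /G /b /=; congr (card_bspline _ (_ - _)%:~R * s _); lia.
- rewrite !(shift (delta p)) !(shift n).
  rewrite (_ : ((2 * n).+1 - delta p - n = n.+1 - delta p)%N); last by lia.
  apply: eq_big_nat => t _.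
  by rewrite /G /b /=; congr (card_bspline _ (_ - _)%:~R * s _); lia.
- rewrite (@big_cat_nat _ _ _ (n + delta p)) /=; [|lia..].
  rewrite [X in _ + X]big_nat [X in _ + X]big1 ?addr0; last first.
    by move=> k /andP[hk _]; rewrite ltnNge hk.
  rewrite shift addnK [RHS]shift big_nat_rev.
  rewrite (_ : (_ - ((2 * n).+1 - delta p) = n)%N); last by lia.
  apply: eq_big_nat => t /andP[_ tn]; rewrite ifT; last by lia.
  by rewrite /G /b /=; congr (card_bspline _ (_ - _)%:~R * s _); lia.
Qed.

Theorem theorem5 (R : realType) (p n : nat) (D : {set 'I_2})
    (hp : (1 <= p)%N) (hn : (p < n)%N) :
  (forall j : 'I_(nreg p n D),
      col_eigenvector (Creg R p n D) (col j (Ureg R p n D)))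
  /\ Creg R p n D *m Ureg R p n D = Ureg R p n D *m Theta R p n D.
Proof.
have UE (i j : 'I_(nreg p n D)) :
    Ureg R p n D i j = wave R p n D j.+1 (i + offset p D)%:Z.
  by rewrite mxE node_center.
have CU : Creg R p n D *m Ureg R p n D = Ureg R p n D *m Theta R p n D.
  apply/matrixP => i j; rewrite mul_mx_diag !mxE node_center mulrC.
  rewrite -Bhat_row_sum// big_mkord; apply: eq_bigr => m _.
  by rewrite mxE UE.
split=> // j; split.
  have N0 : (0 < nreg p n D)%N by case: j => j /=; lia.
  apply/eqP => /matrixP/(_ (Ordinal N0) 0); rewrite !mxE node_center.
  by apply/eqP; rewrite gt_eqF// wave_first_gt0//; lia.
exists (symbol R p n D j.+1).
rewrite [in LHS]colE mulmxA CU -colE mul_mx_diag; apply/matrixP => i k.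
by rewrite !mxE mulrC.
Qed.
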